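(* Suppose the generator $f$ is such that there exist constants $c_{f,1},c_{f,2}>0$ with $x|f'(x)|\le c_{f,1}$ and $x^2|f''(x)|\le c_{f,2}$ for every $x\in(0,c_{\pi_{\mathrm{ref}}}^{-1})$. Then for any $\theta,\theta'\in\mathbb{R}^{|\mathcal S||\mathcal A|}$ and any initial state distribution $\rho$, $$\left|\tilde V_\lambda^{\pi_{\theta'}}(\rho)-\tilde V_\lambda^{\pi_\theta}(\rho)-\langle\nabla_\theta\tilde V_\lambda^{\pi_\theta}(\rho),\theta'-\theta\rangle\right|\le\frac{L_f(\theta,\theta')}{2}\|\theta'-\theta\|_2^2,$$ where $$L_f(\theta,\theta'):=\frac{8}{(1-\gamma)^3}\Big(r_{\max}+\lambda\sup_{\tilde\theta\in[\theta,\theta']}\|f(w^{\pi_{\tilde\theta}})\|_\infty+\lambda(1-\gamma)\big(c_{f,1}+c_{f,2}/2\big)\Big).$$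
   Context: $(\mathcal S,\mathcal A,\mathcal P,r,\gamma)$ is a discounted Markov decision process with finite state set $\mathcal S$, finite action set $\mathcal A$, transition probabilities $\mathcal P(s'|s,a)$, reward $r:\mathcal S\times\mathcal A\to[0,r_{\max}]$ and discount factor $\gamma\in[0,1)$. For $\theta\in\mathbb{R}^{|\mathcal S||\mathcal A|}$ the softmax policy is $\pi_\theta(a|s)=\exp(\theta_{sa})/\sum_{a'}\exp(\theta_{sa'})$; $\pi(s)$ denotes the distribution $\pi(\cdot|s)$. $\pi_{\mathrm{ref}}$ is a fixed reference policy with $c_{\pi_{\mathrm{ref}}}:=\min_{s,a}\pi_{\mathrm{ref}}(a|s)>0$, and $\lambda>0$ is the regularization parameter. The generator $f:(0,\infty)\to\mathbb{R}$ is convex with $f(1)=0$ and twice differentiable, and $D_f(p,q):=\sum_x q(x)f(p(x)/q(x))$. The regularized value function is $$\tilde V_\lambda^{\pi_\theta}(\rho)=\mathbb{E}\Big[\sum_{t\ge0}\gamma^t\big(r(s_t,a_t)-\lambda D_f(\pi_\theta(s_t),\pi_{\mathrm{ref}}(s_t))\big)\Big],$$ where $s_0\sim\rho$, $a_t\sim\pi_\theta(\cdot|s_t)$, $s_{t+1}\sim\mathcal P(\cdot|s_t,a_t)$. $w^{\pi_\theta}$ is the vector with entries $w^{\pi_\theta}_{sa}=\pi_\theta(a|s)/\pi_{\mathrm{ref}}(a|s)$, $\|f(w^{\pi_\theta})\|_\infty=\max_{s,a}|f(w^{\pi_\theta}_{sa})|$, and $[\theta,\theta']$ is the line segment between $\theta$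 and $\theta'$. *)

(* Defs.v *)
From HB Require Import structures.
From mathcomp Require Import all_boot all_order all_algebra.
From mathcomp Require Import all_classical all_reals all_analysis.

Set Implicit Arguments.
Unset Strict Implicit.
Unset Printing Implicit Defensive.

Import Order.TTheory GRing.Theory Num.Theory.
Import numFieldNormedType.Exports.

Local Open Scope classical_set_scope.
Local Open Scope ring_scope.

Definition is_dist (R : realType) (T : finType) (p : T -> R) : Prop :=
  (forall x, 0 <= p x) /\ \sum_x p x = 1.

(* [trans s a s'] is the probability P(s' | s, a). *)
Record mdp (R : realType) (S A : finType) := MDP {
  trans : S -> A -> S -> R ;
  reward : S -> A -> R ;
  rmax : R ;
  gamma : R ;
  trans_dist : forall s a, is_dist (trans s a) ;
  reward_bound : forall s a, 0 <= reward s a <= rmax ;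
  gamma_bound : 0 <= gamma < 1 }.

(* [pi s a] is pi(a | s). *)
Definition is_policy (R : realType) (S A : finType) (pi : S -> A -> R) : Prop :=
  forall s, is_dist (pi s).

Definition param (R : realType) (S A : finType)
    (theta : 'M[R]_(#|S|, #|A|)) (s : S) (a : A) : R :=
  theta (enum_rank s) (enum_rank a).

Definition softmax (R : realType) (S A : finType)
    (theta : 'M[R]_(#|S|, #|A|)) (s : S) (a : A) : R :=
  expR (param theta s a) / \sum_(b : A) expR (param theta s b).

(* Entries of a policy are at most 1, so the default value 1 of the iterated
   minimum does not affect it. *)
Definition min_prob (R : realType) (S A : finType) (pi : S -> A -> R) : R :=
  \big[Order.min/1]_(x : S * A) pi x.1 x.2.

Definition policy_ratio (R : realType) (S A : finType) (pi piref : S -> A -> R)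
    (s : S) (a : A) : R := pi s a / piref s a.

Definition fdiv (R : realType) (T : finType) (f : R -> R) (p q : T -> R) : R :=
  \sum_x q x * f (p x / q x).

Definition supnorm (R : realType) (S A : finType) (w : S -> A -> R) : R :=
  \big[Order.max/0]_(x : S * A) `|w x.1 x.2|.

(* [f] is a function on (0, +oo); its values elsewhere are irrelevant. *)
Record is_generator (R : realType) (f : R -> R) : Prop := IsGenerator {
  generator_convex :
    convex_function (`]0, +oo[%classic : set (convex_lmodType R^o)) f ;
  generator_1 : f 1 = 0 ;
  generator_derivable : forall x : R, 0 < x -> derivable f x 1 ;
  generator_derivable2 : forall x : R, 0 < x -> derivable (derive1 f) x 1 }.

(* The processes [s_ t] and [a_ t] satisfy s_0 ~ rho, a_t ~ pi(. | s_t) and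
   s_(t+1) ~ P(. | s_t, a_t), expressed by the probabilities of all the finite
   histories (s_0, a_0, ..., s_t, a_t). *)
Record is_trajectory (R : realType) (S A : finType) (M : mdp R S A)
    (rho : S -> R) (pi : S -> A -> R)
    (d : measure_display) (Omega : measurableType d) (Pr : probability Omega R)
    (s_ : nat -> Omega -> S) (a_ : nat -> Omega -> A) : Prop := IsTrajectory {
  state_measurable : forall t s, measurable (s_ t @^-1` [set s]) ;
  action_measurable : forall t a, measurable (a_ t @^-1` [set a]) ;
  trajectory_law : forall (t : nat) (s : nat -> S) (a : nat -> A),
    Pr [set w | forall i, (i <= t)%N -> s_ i w = s i /\ a_ i w = a i] =
    (rho (s 0%N) * pi (s 0%N) (a 0%N) *
     \prod_(i < t) (trans M (s i) (a i) (s i.+1) *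
                    pi (s i.+1) (a i.+1)))%:E }.

Definition regularized_return (R : realType) (S A : finType) (M : mdp R S A)
    (f : R -> R) (lambda : R) (piref pi : S -> A -> R)
    (s : nat -> S) (a : nat -> A) : R :=
  limn (series (fun t : nat => gamma M ^+ t *
    (reward M (s t) (a t) - lambda * fdiv f (pi (s t)) (piref (s t))))).

Definition regularized_value (R : realType) (S A : finType) (M : mdp R S A)
    (f : R -> R) (lambda : R) (piref pi : S -> A -> R)
    (d : measure_display) (Omega : measurableType d) (Pr : probability Omega R)
    (s_ : nat -> Omega -> S) (a_ : nat -> Omega -> A) : R :=
  fine ('E_Pr[fun w => regularized_return M f lambda piref pi
                         (s_ ^~ w) (a_ ^~ w)])%E.

Definition dot (R : realType) (m n : nat) (u v : 'M[R]_(m, n)) : R :=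
  \sum_i \sum_j u i j * v i j.

(* The norm that the library puts on matrices is the sup norm. *)
Definition l2norm (R : realType) (m n : nat) (u : 'M[R]_(m, n)) : R :=
  Num.sqrt (dot u u).

Definition gradient (R : realType) (m n : nat) (F : 'M[R]_(m, n) -> R)
    (theta : 'M[R]_(m, n)) : 'M[R]_(m, n) :=
  \matrix_(i, j) 'D_(delta_mx i j) F theta.

Definition segment (R : realType) (m n : nat) (u v : 'M[R]_(m, n)) :
    set 'M[R]_(m, n) :=
  [set (1 - t) *: u + t *: v | t in `[0, 1]].

Definition smoothness (R : realType) (S A : finType) (M : mdp R S A)
    (f : R -> R) (lambda : R) (piref : S -> A -> R) (cf1 cf2 : R)
    (theta theta' : 'M[R]_(#|S|, #|A|)) : R :=
  8 / (1 - gamma M) ^+ 3 *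
  (rmax M
   + lambda * sup [set supnorm (fun s a => f (policy_ratio (softmax u) piref s a))
                  | u in segment theta theta']
   + lambda * (1 - gamma M) * (cf1 + cf2 / 2)).

(* Main.v *)
Require Import Defs.
From HB Require Import structures.
From mathcomp Require Import all_boot all_order all_algebra.
From mathcomp Require Import all_classical all_reals all_analysis.
From mathcomp Require Import measurable_realfun.
From mathcomp Require Import ring lra.

Set Implicit Arguments.
Unset Strict Implicit.
Unset Printing Implicit Defensive.

Import Order.TTheory GRing.Theory Num.Theory.
Import numFieldNormedType.Exports.

Local Open Scope classical_set_scope.
Local Open Scope ring_scope.

(** Write [d] for the discounted occupancy measure of the policy
[softmax theta] started from [rho], [v] for its state values, [v'] for the state
values of [softmax theta'], [P] and [P'] for the two transition matrices on the
states, [T] and [T'] for the two Bellman operators, and [n] for the Euclidean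
norm of [theta' - theta].  The proof rests on an exact expression of the
first-order remainder of the value, so that only functions of the softmax
weights at one state are differentiated.

The value is the [rho]-average of the fixed point of a Bellman operator, and
pairing [h - gamma P h] with the occupancy measure gives the [rho]-average of
[h].  With [h = v' - v] this yields (lemma [performance_difference])

  V(theta') - V(theta)
    = sum_s d(s) [(T' v - T v)(s) + gamma ((P' - P)(v' - v))(s)].

At a fixed state, [T v] is a sum over the actions of a function of the softmax
weights.  Along a line whose direction [u] has entries bounded by [n], a softmax
weight [p_a] has first derivative [p_a (u_a - ubar)] and second derivative
[p_a ((u_a - ubar)^2 - var)], where [|u_a - ubar| <= 2n] and
[|(u_a - ubar)^2 - var| <= 4n^2].  Hence the two assumptions on [f] bound the
step [T' v - T v] by [2n (G + lambda cf1)] and its first-order remainder by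
[2n^2 (G + lambda (cf1 + cf2))], where [G = B / (1 - gamma)] bounds the action
values and [B = rmax + lambda |f(w)|] is taken at [theta] only (lemmas
[softmax_sum_lipschitz] and [softmax_sum_taylor]).

The bound on [T' v - T v] also bounds [v' - v], by
[2n (G + lambda cf1) / (1 - gamma)] (lemma [bellman_bound]), so the mixed term
is of second order too.  As [d] has mass [1 / (1 - gamma)], summing these bounds
gives a remainder of absolute value at most

  (n^2 / (1 - gamma)) [2G + 2 lambda (cf1 + cf2)
                       + 4 gamma (G + lambda cf1) / (1 - gamma)],

which is at most half the announced constant times [n^2], even with the supremum
of [|f(w)|] over the segment replaced by its value at [theta].  This last bound
involves [theta'] only through [n], so it also shows that the value is
differentiable at [theta] and identifies its gradient (lemma
[gradient_quadratic_error]).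

The expectation that defines the value is reduced to the occupancy measure by
computing the law of [(s_t, a_t)] from the probabilities of the histories and
exchanging the discounted sum with the expectation by dominated convergence
(lemma [expected_discounted]). *)

(** * One-variable calculus *)

Lemma is_derive_bigsum (R : realType) (I : finType) (h : I -> R -> R)
    (dh : I -> R) (t : R) :
  (forall i, is_derive t 1 (h i) (dh i)) ->
  is_derive t 1 (fun x => \sum_i h i x) (\sum_i dh i).
Proof.
move=> hdh.
have -> : (fun x => \sum_i h i x) = \sum_i h i.
  by apply/funext => x; rewrite fct_sumE.
by elim/big_ind2 : _ => [||i _]; [exact: is_derive_cst
  | move=> *; exact: is_deriveD | exact: hdh].
Qed.

Lemma mvt_everywhere (R : realType) (phi phi1 : R -> R) (a b : R) :
  a < b -> (forall t : R, is_derive t 1 phi (phi1 t)) ->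
  exists2 c, a < c < b & phi b - phi a = phi1 c * (b - a).
Proof.
move=> ab dphi.
have [|c cab ->] := @MVT R phi phi1 a b ab (fun x _ => dphi x).
  apply: derivable_within_continuous => x _.
  by have [] := dphi x.
by exists c => //; move: cab; rewrite in_itv.
Qed.

Lemma unit_step_bound (R : realType) (phi phi1 : R -> R) (K : R) :
  (forall t : R, is_derive t 1 phi (phi1 t)) -> (forall t, `|phi1 t| <= K) ->
  `|phi 1 - phi 0| <= K.
Proof.
move=> dphi le_phi1.
have [c _ ->] := mvt_everywhere (ltr01 : (0 : R) < 1) dphi.
by rewrite subr0 mulr1.
Qed.

(** The derivative of [phi t - phi1 0 * t - K t^2 / 2] is nonpositive for
nonnegative [t]; no continuity of [phi2] is needed. *)
Lemma unit_taylor_ub (R : realType) (phi phi1 phi2 : R -> R) (K : R) :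
  (forall t : R, is_derive t 1 phi (phi1 t)) ->
  (forall t : R, is_derive t 1 phi1 (phi2 t)) -> (forall t, phi2 t <= K) ->
  phi 1 - phi 0 - phi1 0 <= K / 2.
Proof.
move=> dphi dphi1 le_phi2.
pose g t := phi t - phi1 0 * t - K / 2 * t ^+ 2.
have dg (t : R) : is_derive t 1 g (phi1 t - phi1 0 - K * t).
  have dphit := dphi t.
  apply: is_derive_eq.
  rewrite /GRing.scale/= !mulr1; lra.
have [c /andP[c0 _]] := mvt_everywhere (ltr01 : (0 : R) < 1) dg.
have [e _] := mvt_everywhere c0 dphi1.
have := le_phi2 e.
rewrite /g !subr0 mulr1 => le_e -> eqg.
have : phi2 e * c <= K * c by rewrite ler_pM2r.
move: eqg; rewrite expr0n expr1n/= !mulr1 !mulr0 !subr0; lra.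
Qed.

Lemma unit_taylor_bound (R : realType) (phi phi1 phi2 : R -> R) (K : R) :
  (forall t : R, is_derive t 1 phi (phi1 t)) ->
  (forall t : R, is_derive t 1 phi1 (phi2 t)) -> (forall t, `|phi2 t| <= K) ->
  `|phi 1 - phi 0 - phi1 0| <= K / 2.
Proof.
move=> dphi dphi1 le_phi2; rewrite ler_norml; apply/andP; split; last first.
  by apply: (unit_taylor_ub dphi dphi1) => t; exact: le_trans (ler_norm _) _.
have dN (h h1 : R -> R) : (forall t : R, is_derive t 1 h (h1 t)) ->
    forall t : R, is_derive t 1 (- h) (- h1 t).
  by move=> dh t; exact: is_deriveN.
have phi2N (t : R) : (- phi2) t <= K.
  by apply: le_trans (le_phi2 t); rewrite -normrN ler_norm.
have := unit_taylor_ub (dN _ _ dphi) (dN _ _ dphi1) phi2N.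
rewrite !fctE; lra.
Qed.

Lemma is_derive_mulR (R : realType) (f g : R -> R) (t a b : R) :
  is_derive t 1 f a -> is_derive t 1 g b ->
  is_derive t 1 (fun x => f x * g x) (a * g t + f t * b).
Proof.
move=> df dg; have /is_derive_eq := is_deriveM df dg; apply.
by rewrite /GRing.scale/= addrC (mulrC a).
Qed.

(** * Softmax weights along a line *)

(** The softmax distribution on [A] with logits [x]; [softmax theta s] is
convertible to [expweight (param theta s)]. *)
Definition expweight (R : realType) (A : finType) (x : A -> R) (a : A) : R :=
  expR (x a) / \sum_b expR (x b).

(** The mean of [u] under the weights [p]. *)
Definition average (R : realType) (A : finType) (p u : A -> R) : R :=
  \sum_b p b * u b.

(** The point [x + t u]. *)
Definition line (R : realType) (A : finType) (x u : A -> R) (t : R) (a : A) : R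
  := x a + t * u a.

Lemma dist_card_gt0 (R : realType) (T : finType) (p : T -> R) :
  is_dist p -> (0 < #|T|)%N.
Proof.
move=> [_ p1]; rewrite lt0n; apply/eqP => /card0_eq T0.
by move: p1; rewrite big_pred0// => /eqP; rewrite eq_sym oner_eq0.
Qed.

Section expweight.
Variables (R : realType) (A : finType).
Implicit Types (x u p g : A -> R).

Lemma expsum_gt0 x : (0 < #|A|)%N -> 0 < \sum_b expR (x b).
Proof.
move=> /card_gt0P[a _]; rewrite (bigD1 a)//= ltr_pwDl ?expR_gt0//.
by apply: sumr_ge0 => b _; exact: expR_ge0.
Qed.

Lemma expweight_gt0 x a : 0 < expweight x a.
Proof.
by rewrite divr_gt0 ?expR_gt0// expsum_gt0//; apply/card_gt0P; exists a.
Qed.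

Lemma expweight_sum1 x : (0 < #|A|)%N -> \sum_a expweight x a = 1.
Proof. by move=> A0; rewrite -mulr_suml divff// gt_eqF// expsum_gt0. Qed.

Lemma expweight_dist x : (0 < #|A|)%N -> is_dist (expweight x).
Proof.
by move=> A0; split=> [a|]; [exact/ltW/expweight_gt0 | exact: expweight_sum1].
Qed.

Lemma average_sub p u a : is_dist p ->
  u a - average p u = \sum_b p b * (u a - u b).
Proof.
move=> [_ p1]; rewrite /average -[in LHS](mul1r (u a)) -p1 mulr_suml -sumrB.
by apply: eq_bigr => b _; rewrite mulrBr.
Qed.

Lemma average_le p u K : is_dist p -> (forall a, `|u a| <= K) ->
  `|average p u| <= K.
Proof.
move=> [p0 p1] uK; apply: le_trans (ler_norm_sum _ _ _) _.
rewrite -[leRHS]mul1r -p1 mulr_suml ler_sum// => a _.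
by rewrite normrM ger0_norm// ler_wpM2l.
Qed.

Lemma deviation_le p u n a : is_dist p -> (forall a, `|u a| <= n) ->
  `|u a - average p u| <= 2 * n.
Proof.
move=> pd un; apply: le_trans (ler_normB _ _) _.
by rewrite mulr_natl mulr2n lerD// average_le.
Qed.

Lemma is_derive_exp_line x u a (t : R) :
  is_derive t 1 (fun t => expR (line x u t a)) (expR (line x u t a) * u a).
Proof.
apply: is_derive1_comp.
have dt := is_derive_mulR (is_derive_id t 1) (is_derive_cst (u a) t 1).
have /is_derive_eq := is_deriveD (is_derive_cst (x a) t 1) dt.
by apply; rewrite add0r mul1r mulr0 addr0.
Qed.

Lemma is_derive_expweight x u a (t : R) :
  is_derive t 1 (fun t => expweight (line x u t) a)
    (expweight (line x u t) a * (u a - average (expweight (line x u t)) u)).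
Proof.
have A0 : (0 < #|A|)%N by apply/card_gt0P; exists a.
have Z0 := lt0r_neq0 (expsum_gt0 (line x u t) A0).
have dZ : is_derive t 1 (fun t => \sum_b expR (line x u t b))
                (\sum_b expR (line x u t b) * u b).
  by apply: is_derive_bigsum => b; exact: is_derive_exp_line.
have dZV := is_deriveV Z0 dZ.
have := is_derive_mulR (is_derive_exp_line x u a t) dZV.
move=> /is_derive_eq; apply.
have -> : average (expweight (line x u t)) u =
    (\sum_b expR (line x u t b) * u b) / \sum_b expR (line x u t b).
  by rewrite /average mulr_suml; apply: eq_bigr => b _; rewrite mulrAC.
by rewrite /GRing.scale/= /expweight; field; exact: Z0.
Qed.

(** The variance of [u] under the weights [p]. *)
Definition weighted_var p u := average p (fun a => (u a - average p u) ^+ 2).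

Lemma average_deviation p u : is_dist p ->
  average p (fun a => u a - average p u) = 0.
Proof.
move=> [_ p1]; rewrite /average.
under eq_bigr do rewrite mulrBr.
by rewrite sumrB -mulr_suml p1 mul1r subrr.
Qed.

Lemma weighted_varE p u : is_dist p ->
  weighted_var p u = \sum_a p a * (u a - average p u) * u a.
Proof.
move=> pd; apply: subr0_eq; rewrite -sumrB.
rewrite (eq_bigr (fun a => - average p u * (p a * (u a - average p u)))).
  by rewrite -mulr_sumr -/(average _ _) average_deviation ?mulr0.
by move=> a _; ring.
Qed.

Lemma is_derive_average x u (t : R) : (0 < #|A|)%N ->
  is_derive t 1 (fun t => average (expweight (line x u t)) u)
    (weighted_var (expweight (line x u t)) u).
Proof.
move=> A0; rewrite weighted_varE; last exact: expweight_dist.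
apply: is_derive_bigsum => a.
have := is_derive_mulR (is_derive_expweight x u a t) (is_derive_cst (u a) t 1).
by move=> /is_derive_eq; apply; rewrite mulr0 addr0.
Qed.

Lemma square_deviation_bound p u n a : is_dist p -> (forall a, `|u a| <= n) ->
  0 <= (u a - average p u) ^+ 2 <= 4 * n ^+ 2.
Proof.
move=> pd un; rewrite sqr_ge0/= -real_normK ?num_real//.
have := deviation_le a pd un; have := normr_ge0 (u a - average p u).
nra.
Qed.

Lemma weighted_var_bound p u n : is_dist p -> (forall a, `|u a| <= n) ->
  0 <= weighted_var p u <= 4 * n ^+ 2.
Proof.
move=> pd un; apply/andP; split.
  by apply: sumr_ge0 => a _; rewrite mulr_ge0 ?sqr_ge0//; case: pd.
apply: le_trans (ler_norm _) _; apply: average_le => // a.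
have /andP[? ?] := square_deviation_bound a pd un.
by rewrite ger0_norm.
Qed.

(** Both quantities lie between 0 and [4 n^2], hence so does the absolute value
of their difference. *)
Lemma square_deviation_le p u n a : is_dist p -> (forall a, `|u a| <= n) ->
  `|(u a - average p u) ^+ 2 - weighted_var p u| <= 4 * n ^+ 2.
Proof.
move=> pd un; have := square_deviation_bound a pd un.
have := weighted_var_bound pd un; rewrite ler_norml; lra.
Qed.

End expweight.

Lemma singleton_expweight (R : realType) (A : finType) (x : A -> R) (a : A) :
  (#|A| <= 1)%N -> expweight x a = 1.
Proof.
move=> /fintype_le1P A1; have A0 : (0 < #|A|)%N by apply/card_gt0P; exists a.
rewrite -(expweight_sum1 x A0) (bigD1 a)//= big_pred0 ?addr0// => b.
by rewrite (A1 b a) eqxx.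
Qed.

Lemma expweight_lt1 (R : realType) (A : finType) (x : A -> R) (a : A) :
  (1 < #|A|)%N -> expweight x a < 1.
Proof.
move=> A1; have [b ba] : exists b, b != a.
  have /card_gt1P[b [c [_ _ bc]]] := A1.
  have [ba|] := eqVneq b a; last by exists b.
  by exists c; rewrite -ba eq_sym.
rewrite -(expweight_sum1 x (ltnW A1)) (bigD1 a)//= (bigD1 b)//=.
rewrite ltrDl ltr_pwDl ?expweight_gt0//.
by apply: sumr_ge0 => c _; exact/ltW/expweight_gt0.
Qed.

Lemma average_deviation_singleton (R : realType) (A : finType)
    (p u : A -> R) (a : A) :
  (#|A| <= 1)%N -> is_dist p -> u a - average p u = 0.
Proof.
move=> /fintype_le1P A1 pd; rewrite average_sub//.
by apply: big1 => b _; rewrite (A1 b a) subrr mulr0.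
Qed.

(** First-order expansion of [x |-> sum_a H a (expweight x a)].  The bounds on
the derivatives of [H] are only required at weights strictly between 0 and 1:
with a single action the weight is constantly 1 and the sum does not vary. *)
Section softmax_taylor.
Variables (R : realType) (A : finType) (H H1 H2 : A -> R -> R) (K1 K2 : R).
Hypothesis dH : forall a (p : R), 0 < p -> is_derive p 1 (H a) (H1 a p).
Hypothesis dH1 : forall a (p : R), 0 < p -> is_derive p 1 (H1 a) (H2 a p).
Hypothesis H1_bound : forall p : A -> R, is_dist p ->
  (forall a, 0 < p a < 1) -> \sum_a p a * `|H1 a (p a)| <= K1.
Hypothesis H2_bound : forall p : A -> R, is_dist p ->
  (forall a, 0 < p a < 1) -> \sum_a p a ^+ 2 * `|H2 a (p a)| <= K2.
Hypotheses (K1_ge0 : 0 <= K1) (K2_ge0 : 0 <= K2).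

(** The derivative of the sum at the weights [p] in the direction [u]. *)
Definition softmax_slope (p u : A -> R) : R :=
  \sum_a H1 a (p a) * (p a * (u a - average p u)).

(* The second derivative of the sum along the line of direction [u]. *)
Let curvature (p u : A -> R) : R :=
  \sum_a (H2 a (p a) * (p a * (u a - average p u)) ^+ 2
          + H1 a (p a) * (p a * ((u a - average p u) ^+ 2 - weighted_var p u))).

Lemma is_derive_softmax_sum x u (t : R) :
  is_derive t 1 (fun t => \sum_a H a (expweight (line x u t) a))
    (softmax_slope (expweight (line x u t)) u).
Proof.
apply: is_derive_bigsum => a; apply: is_derive1_comp.
  exact/dH/expweight_gt0.
exact: is_derive_expweight.
Qed.

Lemma is_derive_softmax_slope x u (t : R) :
  is_derive t 1 (fun t => softmax_slope (expweight (line x u t)) u)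
    (curvature (expweight (line x u t)) u).
Proof.
apply: is_derive_bigsum => a.
have A0 : (0 < #|A|)%N by apply/card_gt0P; exists a.
have dp := is_derive_expweight x u a t.
have du := is_deriveB (is_derive_cst (u a) t 1) (is_derive_average x u t A0).
have dpH1 := @is_derive1_comp R (H1 a) (fun t => expweight (line x u t) a) t
  _ _ (dH1 a (expweight_gt0 (line x u t) a)) dp.
have /is_derive_eq := is_derive_mulR dpH1 (is_derive_mulR dp du).
apply; rewrite !fctE/=; ring.
Qed.

Variables (x u : A -> R) (n : R).
Hypothesis u_le : forall a, `|u a| <= n.

Let lineK t a : (1 < #|A|)%N -> 0 < expweight (line x u t) a < 1.
Proof. by move=> A1; rewrite expweight_gt0/= expweight_lt1. Qed.

Lemma softmax_sum_lipschitz : 0 <= n ->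
  `|\sum_a H a (expweight (x \+ u) a) - \sum_a H a (expweight x a)|
    <= 2 * n * K1.
Proof.
move=> n0; have [A1|A1] := leqP #|A| 1.
  rewrite -sumrB big1 ?normr0 ?mulr_ge0// => a _.
  by rewrite !singleton_expweight// subrr.
have := @unit_step_bound R _ _ (2 * n * K1) (is_derive_softmax_sum x u).
rewrite (_ : line x u 1 = x \+ u); last first.
  by apply/funext => a; rewrite /line mul1r.
rewrite (_ : line x u 0 = x); last first.
  by apply/funext => a; rewrite /line mul0r addr0.
apply => t; rewrite /softmax_slope.
have p01 := fun a => lineK t a A1.
move: (expweight _) (expweight_dist (line x u t) (ltnW A1)) p01 => p pd p01.
have le_K1 := H1_bound pd p01.
apply: le_trans (ler_norm_sum _ _ _) _.
apply: (@le_trans _ _ (\sum_a (2 * n * (p a * `|H1 a (p a)|)))); last first.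
  by rewrite -mulr_sumr ler_wpM2l// mulr_ge0.
apply: ler_sum => a _; have /andP[p0 _] := p01 a.
rewrite !normrM (gtr0_norm p0).
rewrite [leLHS](_ : _ = `|u a - average p u| * (p a * `|H1 a (p a)|));
  last by ring.
rewrite ler_wpM2r ?deviation_le//.
by rewrite mulr_ge0// ltW.
Qed.

Lemma softmax_sum_taylor :
  `|\sum_a H a (expweight (x \+ u) a) - \sum_a H a (expweight x a)
    - softmax_slope (expweight x) u| <= 2 * n ^+ 2 * (K1 + K2).
Proof.
have [A1|A1] := leqP #|A| 1.
  rewrite -sumrB /softmax_slope -sumrB big1.
    by rewrite normr0 mulr_ge0 ?addr_ge0// pmulr_rge0 ?sqr_ge0.
  move=> a _; rewrite average_deviation_singleton//.
    by rewrite !singleton_expweight// !mulr0 !subrr.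
  by apply: expweight_dist; apply/card_gt0P; exists a.
have := @unit_taylor_bound R _ _ _ (4 * n ^+ 2 * (K1 + K2))
  (is_derive_softmax_sum x u) (is_derive_softmax_slope x u).
rewrite (_ : line x u 1 = x \+ u); last first.
  by apply/funext => a; rewrite /line mul1r.
rewrite (_ : line x u 0 = x); last first.
  by apply/funext => a; rewrite /line mul0r addr0.
rewrite (_ : 4 * n ^+ 2 * (K1 + K2) / 2 = 2 * n ^+ 2 * (K1 + K2)); last by lra.
apply => t; rewrite /curvature.
have p01 := fun a => lineK t a A1.
move: (expweight _) (expweight_dist (line x u t) (ltnW A1)) p01 => p pd p01.
apply: le_trans (ler_norm_sum _ _ _) _.
apply: (@le_trans _ _ (\sum_a (4 * n ^+ 2 * (p a ^+ 2 * `|H2 a (p a)|)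
   + 4 * n ^+ 2 * (p a * `|H1 a (p a)|)))); last first.
  rewrite big_split/= -!mulr_sumr -mulrDr.
  apply: ler_wpM2l; first by rewrite pmulr_rge0 ?sqr_ge0.
  by rewrite addrC lerD ?H1_bound ?H2_bound.
apply: ler_sum => a _; have /andP[p0 _] := p01 a.
apply: le_trans (ler_normD _ _) _; apply: lerD.
  have /andP[v0 vn] := square_deviation_bound a pd u_le.
  rewrite normrM normrX normrM (gtr0_norm p0) exprMn real_normK ?num_real//.
  rewrite [leLHS](_ : _ = (u a - average p u) ^+ 2 *
    (p a ^+ 2 * `|H2 a (p a)|)).
    by rewrite ler_wpM2r// mulr_ge0// sqr_ge0.
  by ring.
rewrite !normrM (gtr0_norm p0).
rewrite [leLHS](_ : _ = `|(u a - average p u) ^+ 2 - weighted_var p u| *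
  (p a * `|H1 a (p a)|)); last by ring.
rewrite ler_wpM2r ?square_deviation_le//.
by rewrite mulr_ge0// ltW.
Qed.

End softmax_taylor.

(** * Discounted sums and Markov chains *)

Lemma cvg_bigsum (R : realType) (I : finType) (x : I -> nat -> R) (l : I -> R) :
  (forall i, x i @ \oo --> l i) ->
  (fun n => \sum_i x i n) @ \oo --> \sum_i l i.
Proof.
move=> xl; rewrite (_ : (fun n => _) = \sum_i x i); last first.
  by apply/funext => n; rewrite fct_sumE.
by elim/big_ind2 : _ => [||i _]; [exact: cvg_cst | move=> *; exact: cvgD
  | exact: xl].
Qed.

(** The sum over [t] of [g^t x_t]; meaningful for bounded [x]. *)
Definition discounted (R : realType) (g : R) (x : nat -> R) : R :=
  limn (series (fun t : nat => g ^+ t * x t)).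

Section discounted.
Variables (R : realType) (g : R).
Hypothesis g01 : 0 <= g < 1.
Implicit Types (x : nat -> R) (C : R).

Lemma discounted_partial_le x C n : (forall t, `|x t| <= C) ->
  `|series (fun t : nat => g ^+ t * x t) n| <= C / (1 - g).
Proof.
have /andP[g0 g1] := g01 => xC.
have C0 : 0 <= C by apply: le_trans (xC 0%N).
apply: le_trans (ler_norm_sum _ _ _) _.
apply: (@le_trans _ _ (series (geometric C g) n)).
  apply: ler_sum => t _; rewrite normrM normrX (ger0_norm g0) mulrC.
  by rewrite ler_wpM2r// exprn_ge0.
rewrite geometric_seriesE ?lt_eqF// ler_pM2r ?invr_gt0 ?subr_gt0//.
by rewrite ler_piMr// gerBl exprn_ge0.
Qed.

Lemma cvg_discounted x C : (forall t, `|x t| <= C) ->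
  series (fun t : nat => g ^+ t * x t) @ \oo --> discounted g x.
Proof.
have /andP[g0 g1] := g01 => xC.
have C0 : 0 <= C by apply: le_trans (xC 0%N).
apply: (@normed_cvg R R^o); apply: (@series_le_cvg R _ (geometric C g)) => //=.
- by move=> n; rewrite mulr_ge0// exprn_ge0.
- move=> t; rewrite normrM normrX (ger0_norm g0) mulrC.
  by rewrite ler_wpM2r// exprn_ge0.
- by apply: is_cvg_geometric_series; rewrite ger0_norm.
Qed.

Lemma discounted_shift x C : (forall t, `|x t| <= C) ->
  discounted g x = x 0%N + g * discounted g (fun t => x t.+1).
Proof.
move=> xC; have cx := cvg_discounted xC.
have cx' := @cvg_discounted (fun t => x t.+1) C (fun t => xC t.+1).
move: cx; rewrite -[X in X -> _]cvg_shiftS => cx.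
rewrite -(cvg_lim (@Rhausdorff R) cx); apply: cvg_lim => //.
rewrite [X in X @ _ --> _](_ : _ = fun n => x 0%N +
    g * series (fun t : nat => g ^+ t * x t.+1) n); last first.
  apply/funext => n; rewrite /series/= big_nat_recl// expr0 mul1r; congr +%R.
  by rewrite mulr_sumr; apply: eq_bigr => i _; rewrite exprS mulrA.
apply: cvgD; first exact: cvg_cst.
by apply: cvgM => //; exact: cvg_cst.
Qed.

Lemma discounted_sum (I : finType) (c : I -> R) (x : I -> nat -> R) C :
  (forall i t, `|x i t| <= C) ->
  discounted g (fun t => \sum_i c i * x i t) = \sum_i c i * discounted g (x i).
Proof.
move=> xC; apply: cvg_lim => //.
rewrite [X in X @ _ --> _](_ : _ = fun n => \sum_i
    c i * series (fun t : nat => g ^+ t * x i t) n); last first.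
  apply/funext => n; rewrite /series/=.
  under eq_bigr do rewrite mulr_sumr.
  rewrite exchange_big/=; apply: eq_bigr => i _; rewrite mulr_sumr.
  by apply: eq_bigr => t _; rewrite mulrCA.
apply: cvg_bigsum => i; apply: cvgM; first exact: cvg_cst.
exact: (cvg_discounted (xC i)).
Qed.

Lemma discounted_ge0 x C : (forall t, 0 <= x t <= C) -> 0 <= discounted g x.
Proof.
have /andP[g0 g1] := g01 => xC; apply: limr_ge.
  apply: cvgP; apply: (@cvg_discounted _ C) => t.
  by have /andP[? ?] := xC t; rewrite ger0_norm.
apply: nearW => n; apply: sumr_ge0 => t _.
by have /andP[? ?] := xC t; rewrite mulr_ge0// exprn_ge0.
Qed.

End discounted.

(** A Markov chain on [S] with transition matrix [K], discounted by [g]. *)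
Section markov_chain.
Variables (R : realType) (S : finType) (g : R) (K : S -> S -> R).
Hypothesis g01 : 0 <= g < 1.
Hypothesis K_dist : forall s, is_dist (K s).
Implicit Types (rho h e v : S -> R).

(** The operator [v |-> e + g K v] contracts the supremum norm by [g]. *)
Lemma bellman_bound e v E : (forall s, v s = e s + g * \sum_s' K s s' * v s') ->
  (forall s, `|e s| <= E) -> forall s, `|v s| <= E / (1 - g).
Proof.
have /andP[g0 g1] := g01 => ve eE s0.
have [m _ le_m] : exists2 m, true & forall s, `|v s| <= `|v m|.
  case: (@Order.TotalTheory.arg_maxP _ _ S s0 predT (fun s => `|v s|)) => //.
  by move=> m _ le_m; exists m => // s; exact: le_m.
apply: le_trans (le_m s0) _; rewrite ler_pdivlMr ?subr_gt0//.
have : `|v m| <= E + g * `|v m|.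
  rewrite {1}ve; apply: le_trans (ler_normD _ _) _; apply: lerD => //.
  rewrite normrM (ger0_norm g0) ler_wpM2l//.
  apply: le_trans (ler_norm_sum _ _ _) _; have [K0 K1] := K_dist m.
  rewrite -[leRHS]mul1r -K1 mulr_suml ler_sum// => s _.
  by rewrite normrM ger0_norm// ler_wpM2l.
lra.
Qed.

(** The law of the state at time [t] when the initial law is [rho]. *)
Fixpoint state_dist rho (t : nat) : S -> R :=
  if t is t'.+1 then fun s' => \sum_s state_dist rho t' s * K s s' else rho.

Lemma state_dist_dist rho t : is_dist rho -> is_dist (state_dist rho t).
Proof.
move=> rhod; elim: t => [//|t [d0 d1]]; split=> /= [s'|].
  by apply: sumr_ge0 => s _; rewrite mulr_ge0//; case: (K_dist s).
rewrite exchange_big/= -[RHS]d1; apply: eq_bigr => s _.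
by rewrite -mulr_sumr; have [_ ->] := K_dist s; rewrite mulr1.
Qed.

Lemma dist_le1 (T : finType) (p : T -> R) x : is_dist p -> 0 <= p x <= 1.
Proof.
move=> [p0 p1]; rewrite p0/= -p1 (bigD1 x)//= lerDl.
by apply: sumr_ge0 => y _; exact: p0.
Qed.

(** The discounted occupancy measure, of total mass [1 / (1 - g)]. *)
Definition occupancy rho (s : S) : R :=
  discounted g (fun t => state_dist rho t s).

Lemma state_dist_bound rho t s : is_dist rho -> `|state_dist rho t s| <= 1.
Proof.
move=> rhod; have /andP[? ?] := dist_le1 s (state_dist_dist t rhod).
by rewrite ger0_norm.
Qed.

Lemma occupancy_ge0 rho s : is_dist rho -> 0 <= occupancy rho s.
Proof.
move=> rhod; apply: (@discounted_ge0 _ _ g01 _ 1) => t.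
exact/dist_le1/state_dist_dist.
Qed.

Lemma occupancy_flow rho s' : is_dist rho ->
  occupancy rho s' = rho s' + g * \sum_s occupancy rho s * K s s'.
Proof.
move=> rhod; rewrite {1}/occupancy.
rewrite (discounted_shift g01 (fun t => state_dist_bound t s' rhod))/=.
congr (_ + _ * _); under eq_fun do under eq_bigr do rewrite mulrC.
rewrite (discounted_sum g01 (K ^~ s') (fun s t => state_dist_bound t s rhod)).
by apply: eq_bigr => s _; rewrite mulrC.
Qed.

(** The occupancy measure is [rho (I - g K)^-1], stated by duality. *)
Lemma occupancy_balance rho h : is_dist rho ->
  \sum_s occupancy rho s * (h s - g * \sum_s' K s s' * h s') =
  \sum_s rho s * h s.
Proof.
move=> rhod; under eq_bigr do rewrite mulrBr.
rewrite sumrB; apply/eqP; rewrite subr_eq; apply/eqP.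
under eq_bigr do rewrite occupancy_flow// mulrDl.
rewrite big_split/=; congr +%R.
under eq_bigr do rewrite mulr_sumr mulr_suml.
rewrite exchange_big/=; apply: eq_bigr => s _.
rewrite !mulr_sumr; apply: eq_bigr => s' _; ring.
Qed.

Lemma occupancy_sum rho : is_dist rho ->
  \sum_s occupancy rho s = (1 - g)^-1.
Proof.
have /andP[g0 g1] := g01 => rhod; have [_ rho1] := rhod.
have := occupancy_balance (fun=> 1) rhod.
under eq_bigr => s _.
  under eq_bigr do rewrite mulr1.
  have [_ ->] := K_dist s; rewrite mulr1.
  over.
rewrite -!mulr_suml rho1 mulr1 => occ1; apply: (@mulIf _ (1 - g)).
  by rewrite subr_eq0 gt_eqF.
by rewrite occ1 mulVf// subr_eq0 gt_eqF.
Qed.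

Lemma occupancy_average_le rho h E : is_dist rho -> (forall s, `|h s| <= E) ->
  `|\sum_s occupancy rho s * h s| <= E / (1 - g).
Proof.
move=> rhod hE; apply: le_trans (ler_norm_sum _ _ _) _.
rewrite mulrC -(occupancy_sum rhod) mulr_suml ler_sum// => s _.
by rewrite normrM ger0_norm ?occupancy_ge0// ler_wpM2l// occupancy_ge0.
Qed.

(** The expectation of [h] at time [t] as a function of the initial state. *)
Fixpoint expected_reward h (t : nat) : S -> R :=
  if t is t'.+1 then fun s => \sum_s' K s s' * expected_reward h t' s' else h.

Lemma bellman_solution h :
  exists v, forall s, v s = h s + g * \sum_s' K s s' * v s'.
Proof.
exists (fun s => discounted g (fun t => expected_reward h t s)) => s0.
have [C hC] : exists C, forall s, `|h s| <= C.
  exists (\sum_s `|h s|) => s; rewrite (bigD1 s)//= lerDl.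
  exact: sumr_ge0.
have erC t s : `|expected_reward h t s| <= C.
  elim: t s => [//|t IH s] /=.
  apply: le_trans (ler_norm_sum _ _ _) _; have [K0 K1] := K_dist s.
  rewrite -[leRHS]mul1r -K1 mulr_suml ler_sum// => s' _.
  by rewrite normrM ger0_norm// ler_wpM2l.
rewrite (discounted_shift g01 (fun t => erC t s0))/=; congr (_ + _ * _).
by rewrite (discounted_sum g01 _ (fun s t => erC t s)).
Qed.

End markov_chain.

(** * The law of the trajectory and the expected return *)

Lemma measure_finType_bigcup (d : measure_display) (Omega : measurableType d)
    (R : realType) (mu : {measure set Omega -> \bar R}) (T : finType)
    (F : T -> set Omega) :
  trivIset setT F -> (forall i, measurable (F i)) ->
  mu (\bigcup_i F i) = (\sum_i mu (F i))%E.
Proof.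
move=> tF mF; rewrite measure_fin_bigcup//; last exact: finite_finset.
have -> : [set: T] = [set` enum T].
  by apply/seteqP; split => // i _ /=; rewrite mem_enum.
by rewrite -fsbig_seq ?enum_uniq// big_enum.
Qed.

Lemma integral_finType (d : measure_display) (Omega : measurableType d)
    (R : realType) (Pr : probability Omega R) (T : finType)
    (X : Omega -> T) (c : T -> R) :
  (forall x, measurable (X @^-1` [set x])) ->
  Pr.-integrable setT (fun w => (c (X w))%:E) /\
  (\int[Pr]_w (c (X w))%:E = \sum_x (c x)%:E * Pr (X @^-1` [set x]))%E.
Proof.
move=> mX.
have cE : (fun w => (c (X w))%:E) =
    (fun w => (\sum_x ((c x)%:E * (\1_(X @^-1` [set x]) w)%:E)))%E.
  apply/funext => w; rewrite (bigD1 (X w))//= big1 => [|x xX].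
    by rewrite indicE mem_set// mule1 adde0.
  rewrite indicE memNset ?mule0//= => Xx.
  by rewrite Xx eqxx in xX.
have iX x : Pr.-integrable setT (fun w => (\1_(X @^-1` [set x]) w)%:E).
  exact: integrable_indic.
have icX x : Pr.-integrable setT
    (fun w => ((c x)%:E * (\1_(X @^-1` [set x]) w)%:E)%E).
  exact: integrableZl.
rewrite cE; split; first exact: integrable_sum.
rewrite integral_sum//; apply: eq_bigr => x _.
by rewrite integralZl// integral_indic// setIT.
Qed.

(** The sequence [x] with the value at [k] replaced by [y]. *)
Definition update (T : Type) (x : nat -> T) (k : nat) (y : T) (i : nat) : T :=
  if i == k then y else x i.

Section trajectory.
Variables (R : realType) (S A : finType) (M : mdp R S A) (rho : S -> R).
Variable pi : S -> A -> R.

(** The transition matrix of the state process under the policy [pi]. *)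
Definition policy_kernel (s s' : S) : R := \sum_a pi s a * trans M s a s'.

Lemma policy_kernel_dist s : is_policy pi -> is_dist (policy_kernel s).
Proof.
move=> pip; have [p0 p1] := pip s; split=> [s'|].
  apply: sumr_ge0 => a _; rewrite mulr_ge0//.
  by case: (trans_dist M s a).
rewrite exchange_big/= -[RHS]p1; apply: eq_bigr => a _.
by rewrite -mulr_sumr; have [_ ->] := trans_dist M s a; rewrite mulr1.
Qed.

Variables (d : measure_display) (Omega : measurableType d).
Variables (Pr : probability Omega R) (s_ : nat -> Omega -> S).
Variable a_ : nat -> Omega -> A.
Hypothesis traj : is_trajectory M rho pi Pr s_ a_.

(** The event that the states and actions from time [k] to time [t] are those of
[s] and [a]. *)
Definition history (k t : nat) (s : nat -> S) (a : nat -> A) : set Omega :=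
  [set w | forall i, (k <= i <= t)%N -> s_ i w = s i /\ a_ i w = a i].

Lemma measurable_history k t s a : measurable (history k t s a).
Proof.
have -> : history k t s a = \bigcap_i (if (k <= i <= t)%N then
    s_ i @^-1` [set s i] `&` a_ i @^-1` [set a i] else setT).
  apply/seteqP; split => w /= hw i.
    by move=> _; case: ifP => // /hw.
  by move=> kit; have := hw i I; rewrite kit.
apply: bigcapT_measurable => i; case: ifP => // _.
by apply: measurableI; [exact: (state_measurable traj)
  | exact: (action_measurable traj)].
Qed.

Lemma historyS k t s a : (k < t)%N -> history k.+1 t s a =
  \bigcup_(x : S * A) history k t (update s k x.1) (update a k x.2).
Proof.
move=> kt; apply/seteqP; split=> w /=.
  move=> hw; exists (s_ k w, a_ k w) => // i /andP[ki it].
  rewrite /update/=; have [->//|ik] := eqVneq i k.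
  by apply: hw; rewrite it ltn_neqAle eq_sym ik ki.
move=> [[x b] _ hw] i /andP[ki it].
by have := hw i; rewrite /update gtn_eqF// (ltnW ki) it => /(_ isT).
Qed.

Lemma trivIset_history k t s a : (k <= t)%N ->
  trivIset setT
    (fun x : S * A => history k t (update s k x.1) (update a k x.2)).
Proof.
move=> kt; apply/trivIsetP => -[x b] [y c] _ _ /eqP xy.
apply/seteqP; split => // w [/= hx hy]; apply: xy.
have := hx k; have := hy k; rewrite leqnn kt /update eqxx/=.
by move=> /(_ isT)[<- <-] /(_ isT)[<- <-].
Qed.

(** Induction on [k]: the event for [k.+1] is the disjoint union, over the pairs
[(s_k, a_k)], of events for [k]; summing over these pairs turns [state_dist] at
[k] into [state_dist] at [k.+1]. *)
Lemma history_law k t s a : (k <= t)%N ->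
  Pr (history k t s a) =
  (state_dist policy_kernel rho k (s k) * pi (s k) (a k) *
   \prod_(k <= i < t) (trans M (s i) (a i) (s i.+1) *
                       pi (s i.+1) (a i.+1)))%:E.
Proof.
elim: k s a => [|k IH] s a kt.
  by rewrite big_mkord/= -(trajectory_law traj).
rewrite historyS// measure_finType_bigcup; last 2 first.
- exact/trivIset_history/ltnW.
- by move=> x; exact: measurable_history.
rewrite (eq_bigr _ (fun x _ => IH _ _ (ltnW kt))).
rewrite sumEFin; congr EFin.
rewrite -(pair_bigA _ (fun x b => state_dist policy_kernel rho k
    (update s k x k) * pi (update s k x k) (update a k b k) *
    \prod_(k <= i < t) (trans M (update s k x i) (update a k b i)
      (update s k x i.+1) * pi (update s k x i.+1) (update a k b i.+1))))/=.
rewrite !mulr_suml; apply: eq_bigr => x _.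
rewrite /policy_kernel mulr_sumr !mulr_suml; apply: eq_bigr => b _.
rewrite big_ltn// /update eqxx gtn_eqF//.
rewrite (eq_big_nat _ _ (F2 := fun i => trans M (s i) (a i) (s i.+1) *
   pi (s i.+1) (a i.+1))); first by ring.
by move=> i /andP[ki _]; rewrite !gtn_eqF// (leq_trans ki).
Qed.

Lemma state_action_law t (x : S * A) :
  Pr ((fun w => (s_ t w, a_ t w)) @^-1` [set x]) =
  (state_dist policy_kernel rho t x.1 * pi x.1 x.2)%:E.
Proof.
have := @history_law t t (fun=> x.1) (fun=> x.2) (leqnn t).
rewrite big_geq// mulr1 => <-; congr (Pr _); apply/seteqP; split => w /=.
  move=> <- i /andP[ti it]/=.
  by have -> : i = t by apply/eqP; rewrite eqn_leq ti it.
by move=> /(_ t); rewrite leqnn => /(_ isT)[-> ->]; case: (x).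
Qed.

Lemma measurable_state_action t (x : S * A) :
  measurable ((fun w => (s_ t w, a_ t w)) @^-1` [set x]).
Proof.
rewrite [X in measurable X](_ : _ =
    s_ t @^-1` [set x.1] `&` a_ t @^-1` [set x.2]).
  by apply: measurableI; [exact: (state_measurable traj)
    | exact: (action_measurable traj)].
apply/seteqP; split => w /=; first by move=> <-.
by move=> [-> ->]; case: (x).
Qed.

(** The partial sums are dominated by the constant [C / (1 - gamma)], which is
integrable since [Pr] is finite. *)
Lemma expected_discounted (c : S -> A -> R) : is_policy pi -> is_dist rho ->
  fine ('E_Pr[fun w => discounted (gamma M)
                         (fun t => c (s_ t w) (a_ t w))])%E =
  \sum_s occupancy (gamma M) policy_kernel rho s * \sum_a pi s a * c s a.
Proof.
move=> pip rhod; have g01 := gamma_bound M; set g := gamma M in g01 *.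
have [C cC] : exists C, forall x : S * A, `|c x.1 x.2| <= C.
  exists (\sum_(x : S * A) `|c x.1 x.2|) => x.
  by rewrite (bigD1 x)//= lerDl sumr_ge0.
pose ct t w := c (s_ t w) (a_ t w).
have ctC w t : `|ct t w| <= C by exact: (cC (s_ t w, a_ t w)).
pose S_ n w := series (fun t => g ^+ t * ct t w) n.
have int_ct t := integral_finType Pr (fun x : S * A => c x.1 x.2)
  (measurable_state_action t).
have S_E n : (fun w => (S_ n w)%:E) =
    (fun w => \sum_(0 <= t < n) (g ^+ t)%:E * (ct t w)%:E)%E.
  by apply/funext => w; rewrite /S_/= -sumEFin.
have int_S n : Pr.-integrable setT (fun w => (S_ n w)%:E).
  rewrite S_E; apply: integrable_sum => // t _; apply: integrableZl => //.
  by case: (int_ct t).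
have mS n : measurable_fun setT (S_ n).
  by apply/measurable_EFinP; exact: (measurable_int Pr (int_S n)).
have S_cvg w : S_ ^~ w @ \oo --> discounted g (ct ^~ w).
  exact: (cvg_discounted g01 (ctC w)).
have mdisc : measurable_fun setT (fun w => discounted g (ct ^~ w)).
  by apply: (measurable_fun_cvg mS) => w _; exact: S_cvg.
have [_ _ int_cvg] : [/\ Pr.-integrable setT
    (fun w => (discounted g (ct ^~ w))%:E),
    [sequence \int[Pr]_w `|(S_ n w)%:E - (discounted g (ct ^~ w))%:E|]_n%E
      @ \oo --> 0%E &
    [sequence \int[Pr]_w (S_ n w)%:E]_n%E @ \oo -->
      (\int[Pr]_w (discounted g (ct ^~ w))%:E)%E].
  apply: (@dominated_convergence _ _ _ _ _ _ _ _ (EFin \o cst (C / (1 - g)))).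
  - by [].
  - by move=> n; exact: (measurable_int Pr (int_S n)).
  - exact/measurable_EFinP.
  - apply: aeW => w _; apply: cvg_EFin; first exact: nearW.
    exact: S_cvg.
  - exact: finite_measure_integrable_cst.
  - apply: aeW => w n _; rewrite lee_fin.
    exact: (discounted_partial_le g01 n (ctC w)).
rewrite unlock; pose e t := \sum_s (\sum_a pi s a * c s a) *
  state_dist policy_kernel rho t s.
have eE t : (\int[Pr]_w (ct t w)%:E = (e t)%:E)%E.
  have [_ ->] := int_ct t.
  under eq_bigr do rewrite state_action_law -EFinM.
  rewrite sumEFin; congr EFin.
  rewrite -(pair_bigA _ (fun s b => c s b *
    (state_dist policy_kernel rho t s * pi s b)))/=.
  apply: eq_bigr => s _; rewrite mulr_suml; apply: eq_bigr => b _; ring.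
have int_SE n : (\int[Pr]_w (S_ n w)%:E =
    (series (fun t => g ^+ t * e t) n)%:E)%E.
  rewrite S_E integral_sum//; last first.
    by move=> t; apply: integrableZl => //; case: (int_ct t).
  rewrite /series/= -sumEFin; apply: eq_bigr => t _.
  by rewrite integralZl ?eE//; case: (int_ct t).
have dE : discounted g e = \sum_s occupancy g policy_kernel rho s *
    \sum_a pi s a * c s a.
  rewrite (discounted_sum g01 _ (fun s t => state_dist_bound
    (policy_kernel_dist ^~ pip) t s rhod)).
  by apply: eq_bigr => s _; rewrite mulrC.
rewrite -dE; have [K eK] : exists K, forall t, `|e t| <= K.
  exists (\sum_s `|\sum_a pi s a * c s a|) => t.
  apply: le_trans (ler_norm_sum _ _ _) _; apply: ler_sum => s _.
  rewrite normrM ler_piMr// state_dist_bound// => s'.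
  exact: policy_kernel_dist.
have e_cvg : (fun n => (series (fun t => g ^+ t * e t) n)%:E) @ \oo -->
    (discounted g e)%:E.
  apply: cvg_EFin; first exact: nearW.
  exact: (cvg_discounted g01 eK).
have -> // : (\int[Pr]_w (discounted g (ct ^~ w))%:E = (discounted g e)%:E)%E.
move: int_cvg; rewrite (_ : [sequence _]_n%E =
    fun n => (series (fun t => g ^+ t * e t) n)%:E); last exact/funext/int_SE.
by move=> int_cvg; apply: (cvg_unique _ int_cvg e_cvg); exact: ereal_hausdorff.
Qed.

End trajectory.

(** * Differentiability from a quadratic error bound *)

Section quadratic_error.
Variables (R : realType) (m n : nat).
Implicit Types (F : 'M[R]_(m, n) -> R) (G u v x : 'M[R]_(m, n)).

Lemma dot_is_linear G : linear (dot G : 'M[R]_(m, n) -> R).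
Proof.
move=> k u v; rewrite /dot scaler_sumr -big_split/=; apply: eq_bigr => i _.
rewrite scaler_sumr -big_split/=; apply: eq_bigr => j _.
by rewrite !mxE mulrDr /GRing.scale/= mulrCA.
Qed.

HB.instance Definition _ G := GRing.isLinear.Build R 'M[R]_(m, n) R _ (dot G)
  (dot_is_linear G).

Lemma dot_delta G i j : dot G (delta_mx i j) = G i j.
Proof.
rewrite /dot (bigD1 i)//= (bigD1 j)//= !mxE !eqxx mulr1 !big1 ?addr0//.
  move=> i' ii'; apply: big1 => j' _.
  by rewrite mxE (negbTE ii') mulr0.
by move=> j' jj'; rewrite mxE (negbTE jj') andbF mulr0.
Qed.

(** On matrices the norm [`|u|] is the supremum norm. *)
Lemma norm_entry_le u i j : `|u i j| <= `|u|.
Proof.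
rewrite [leRHS]/Num.norm/= mx_normrE.
exact: (le_bigmax _ (fun k => `|u k.1 k.2|) (i, j)).
Qed.

Lemma dot_norm_le G u : `|dot G u| <= (\sum_i \sum_j `|G i j|) * `|u|.
Proof.
apply: le_trans (ler_norm_sum _ _ _) _; rewrite mulr_suml.
apply: ler_sum => i _; apply: le_trans (ler_norm_sum _ _ _) _.
rewrite mulr_suml; apply: ler_sum => j _.
by rewrite normrM ler_wpM2l// norm_entry_le.
Qed.

Lemma l2norm_sqr u : l2norm u ^+ 2 = dot u u.
Proof.
rewrite sqr_sqrtr//; apply: sumr_ge0 => i _; apply: sumr_ge0 => j _.
exact: sqr_ge0.
Qed.

Lemma entry_le_l2norm u i j : `|u i j| <= l2norm u.
Proof.
rewrite -(@ler_pXn2r _ 2)// ?nnegrE ?sqrtr_ge0// l2norm_sqr.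
rewrite real_normK ?num_real// /dot (bigD1 i)//= (bigD1 j)//= -expr2 -addrA.
rewrite lerDl addr_ge0//; first by apply: sumr_ge0 => j' _; exact: sqr_ge0.
by apply: sumr_ge0 => i' _; apply: sumr_ge0 => j' _; exact: sqr_ge0.
Qed.

Lemma l2norm_sqr_le u : l2norm u ^+ 2 <= (m * n)%:R * `|u| ^+ 2.
Proof.
rewrite l2norm_sqr /dot.
apply: (@le_trans _ _ (\sum_(i < m) \sum_(j < n) `|u| ^+ 2)).
  apply: ler_sum => i _; apply: ler_sum => j _.
  rewrite -expr2 -real_normK ?num_real//.
  by rewrite ler_pXn2r// ?nnegrE// norm_entry_le.
rewrite !sumr_const !card_ord -mulrnA mulr_natl mulnC.
exact: lexx.
Qed.

Lemma gradient_quadratic_error F x G C :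
  (forall y, `|F y - F x - dot G (y - x)| <= C * l2norm (y - x) ^+ 2) ->
  differentiable F x /\ gradient F x = G.
Proof.
move=> FG; have cG : continuous (dot G).
  apply/linear_bounded_continuous/linear_boundedP; near=> r.
  move=> u; apply: le_trans (dot_norm_le G u) _; apply: ler_wpM2r => //.
have FGo (e : R) : 0 < e -> \forall h \near (0 : 'M[R]_(m, n)),
    `|F (h + x) - (F x + dot G h)| <= e * `|h|.
  move=> e0.
  (* Within distance [e / (D + 1)] the quadratic error [D * `|h| ^+ 2] is below
     [e * `|h|]; the [+ 1] covers [D = 0]. *)
  pose D := `|C| * (m * n)%:R.
  have D0 : 0 <= D by rewrite mulr_ge0.
  have small : \forall h \near (0 : 'M[R]_(m, n)), `|h| <= e / (D + 1).
    by apply: nbhs0_le; rewrite divr_gt0 ?ltr_wpDl.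
  apply: filterS small => h; rewrite ler_pdivlMr ?ltr_wpDl// => hD.
  rewrite opprD addrA; have := FG (h + x).
  rewrite addrK => /le_trans; apply.
  apply: (@le_trans _ _ (D * `|h| ^+ 2)).
    apply: (@le_trans _ _ (`|C| * l2norm h ^+ 2)).
      by rewrite ler_wpM2r ?sqr_ge0// ler_norm.
    by rewrite /D -mulrA ler_wpM2l// l2norm_sqr_le.
  rewrite expr2 mulrA ler_wpM2r// mulrC; apply: le_trans hD.
  by rewrite ler_wpM2l// lerDl.
have dF : 'd F x = dot G :> ('M[R]_(m, n) -> R).
  by apply: diff_unique => //; apply/eqaddoP.
have diffF : differentiable F x.
  by apply/diff_locallyP; rewrite dF; split => //; apply/eqaddoP.
split=> //; apply/matrixP => i j; rewrite mxE deriveE// dF.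
exact: dot_delta.
Unshelve. all: by end_near. Qed.

End quadratic_error.

(** * The regularized objective of one state-action pair *)

(** The contribution [p q - lambda b f(p / b)] of an action played with
probability [p], of action value [q] and reference probability [b]. *)
Definition regularized_term (R : realType) (f : R -> R)
    (lambda q b p : R) : R :=
  p * q - lambda * (b * f (p / b)).

Section regularized_term.
Variables (R : realType) (f : R -> R).
Hypothesis f_gen : is_generator f.

Lemma is_derive_generator_ratio (b p : R) : 0 < b -> 0 < p ->
  is_derive p 1 (fun x => f (x / b)) (derive1 f (p / b) / b).
Proof.
move=> b0 p0; have pb : 0 < p / b by rewrite divr_gt0.
have df : is_derive (p / b) 1 f (derive1 f (p / b)).
  by rewrite derive1E; exact/derivableP/(generator_derivable f_gen).
have /is_derive_eq := @is_derive1_comp R f (fun x => x / b) p _ _ df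
  (is_derive_mulR (is_derive_id p 1) (is_derive_cst b^-1 p 1)).
by apply; rewrite mul1r mulr0 addr0.
Qed.

Lemma is_derive_generator_ratio2 (b p : R) : 0 < b -> 0 < p ->
  is_derive p 1 (fun x => derive1 f (x / b)) (derive1n 2 f (p / b) / b).
Proof.
move=> b0 p0; have pb : 0 < p / b by rewrite divr_gt0.
have df : is_derive (p / b) 1 (derive1 f) (derive1n 2 f (p / b)).
  rewrite /= [X in is_derive _ _ _ X]derive1E.
  exact/derivableP/(generator_derivable2 f_gen).
have /is_derive_eq := @is_derive1_comp R (derive1 f) (fun x => x / b) p _ _ df
  (is_derive_mulR (is_derive_id p 1) (is_derive_cst b^-1 p 1)).
by apply; rewrite mul1r mulr0 addr0.
Qed.

Lemma is_derive_regularized_term (lambda q b p : R) : 0 < b -> 0 < p ->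
  is_derive p 1 (regularized_term f lambda q b)
    (q - lambda * derive1 f (p / b)).
Proof.
move=> b0 p0.
have d1 := is_derive_mulR (is_derive_id p 1) (is_derive_cst q p 1).
have d2 := is_derive_mulR (is_derive_cst b p 1)
  (is_derive_generator_ratio b0 p0).
have d3 := is_derive_mulR (is_derive_cst lambda p 1) d2.
have /is_derive_eq := is_deriveB d1 d3; apply.
by rewrite /=; field; rewrite gt_eqF.
Qed.

Lemma is_derive_regularized_term2 (lambda q b p : R) : 0 < b -> 0 < p ->
  is_derive p 1 (fun x => q - lambda * derive1 f (x / b))
    (- (lambda * (derive1n 2 f (p / b) / b))).
Proof.
move=> b0 p0.
have d2 := is_derive_mulR (is_derive_cst lambda p 1)
  (is_derive_generator_ratio2 b0 p0).
have /is_derive_eq := is_deriveB (is_derive_cst q p 1) d2; apply.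
by rewrite /= mul0r !add0r.
Qed.

End regularized_term.

Section reference_policy.
Variables (R : realType) (S A : finType) (f : R -> R).
Variables (piref : S -> A -> R) (cf1 cf2 : R).
Hypothesis f_gen : is_generator f.
Hypothesis piref_policy : is_policy piref.
Hypothesis piref_gt0 : 0 < min_prob piref.
Hypothesis f_bound1 : forall x : R, 0 < x < (min_prob piref)^-1 ->
  x * `|derive1 f x| <= cf1.
Hypothesis f_bound2 : forall x : R, 0 < x < (min_prob piref)^-1 ->
  x ^+ 2 * `|derive1n 2 f x| <= cf2.

Lemma min_prob_le s a : min_prob piref <= piref s a.
Proof. exact: (bigmin_le _ (s, a) (fun x : S * A => piref x.1 x.2)). Qed.

Lemma piref_pos s a : 0 < piref s a.
Proof. exact: lt_le_trans (min_prob_le s a). Qed.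

(** Only a probability [p < 1] keeps the ratio off the endpoint of the interval
on which [f] is controlled. *)
Lemma ratio_bound s a (p : R) : 0 < p < 1 ->
  0 < p / piref s a < (min_prob piref)^-1.
Proof.
move=> /andP[p0 p1]; rewrite divr_gt0 ?piref_pos//=.
rewrite ltr_pdivrMr ?piref_pos//; apply: lt_le_trans p1 _.
by rewrite mulrC ler_pdivlMr// mul1r min_prob_le.
Qed.

Lemma generator_bound1 s a (p : R) : 0 < p < 1 ->
  p * `|derive1 f (p / piref s a)| <= piref s a * cf1.
Proof.
move=> p01; have b0 := piref_pos s a.
have := f_bound1 (ratio_bound s a p01).
by rewrite mulrAC ler_pdivrMr// mulrC (mulrC cf1).
Qed.

Lemma generator_bound2 s a (p : R) : 0 < p < 1 ->
  p ^+ 2 * (`|derive1n 2 f (p / piref s a)| / piref s a) <= piref s a * cf2.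
Proof.
move=> p01; have b0 := piref_pos s a.
have := f_bound2 (ratio_bound s a p01).
rewrite -(ler_pM2l b0); apply: le_trans.
by rewrite le_eqVlt; apply/orP; left; apply/eqP; field; rewrite gt_eqF.
Qed.

Variables (lambda G : R) (q : A -> R) (s : S).
Hypothesis lambda_ge0 : 0 <= lambda.
Hypothesis q_le : forall a, `|q a| <= G.

Lemma regularized_slope_bound (p : A -> R) : is_dist p ->
  (forall a, 0 < p a < 1) ->
  \sum_a p a * `|q a - lambda * derive1 f (p a / piref s a)|
    <= G + lambda * cf1.
Proof.
move=> [_ p1] p01; have [_ b1] := piref_policy s.
apply: (@le_trans _ _ (\sum_a (p a * G + lambda * (piref s a * cf1)))).
  apply: ler_sum => a _; have /andP[p0 _] := p01 a.
  apply: (@le_trans _ _ (p a * (`|q a| +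
      lambda * `|derive1 f (p a / piref s a)|))).
    rewrite ler_pM2l//; apply: le_trans (ler_normB _ _) _.
    by rewrite normrM (ger0_norm lambda_ge0).
  rewrite mulrDr lerD ?ler_pM2l// mulrCA ler_wpM2l//.
  exact: generator_bound1.
by rewrite big_split/= -mulr_suml -mulr_sumr -mulr_suml p1 b1 !mul1r.
Qed.

Lemma regularized_curvature_bound (p : A -> R) : is_dist p ->
  (forall a, 0 < p a < 1) ->
  \sum_a p a ^+ 2 * `|- (lambda * (derive1n 2 f (p a / piref s a) / piref s a))|
    <= lambda * cf2.
Proof.
move=> _ p01; have [_ b1] := piref_policy s.
apply: (@le_trans _ _ (\sum_a lambda * (piref s a * cf2))).
  apply: ler_sum => a _; rewrite normrN normrM (ger0_norm lambda_ge0).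
  rewrite mulrCA ler_wpM2l// normrM normfV (gtr0_norm (piref_pos s a)).
  exact: generator_bound2.
by rewrite -mulr_sumr -mulr_suml b1 mul1r.
Qed.

End reference_policy.

(** * The value function *)

Section supremum_norm.
Variables (R : realType) (S A : finType).
Implicit Types (w : S -> A -> R).

Lemma supnorm_le w K : 0 <= K -> (forall s a, `|w s a| <= K) -> supnorm w <= K.
Proof. by move=> K0 wK; apply: bigmax_le. Qed.

Lemma entry_le_supnorm w s a : `|w s a| <= supnorm w.
Proof. exact: (le_bigmax _ (fun x : S * A => `|w x.1 x.2|) (s, a)). Qed.

Lemma supnorm_ge0 w : 0 <= supnorm w.
Proof. exact: bigmax_ge_id. Qed.

End supremum_norm.

Section softmax_policy.
Variables (R : realType) (S A : finType).
Implicit Types (theta : 'M[R]_(#|S|, #|A|)).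

Lemma param_shift theta theta' s :
  param theta' s = param theta s \+ param (theta' - theta) s.
Proof.
by apply/funext => a; rewrite /param/= !mxE addrCA subrr addr0.
Qed.

Lemma softmax_policy theta : (0 < #|A|)%N -> is_policy (softmax theta).
Proof. by move=> A0 s; exact: (expweight_dist (param theta s) A0). Qed.

(** This makes the supremum in [smoothness] a genuine one, although [f] may be
unbounded near 0: along the segment, [f] of a policy ratio varies by at most
[2 n cf1]. *)
Lemma softmax_generator_bounded (f : R -> R) (piref : S -> A -> R)
    (cf1 : R) theta theta' :
  is_generator f -> is_policy piref -> 0 < min_prob piref -> 0 <= cf1 ->
  (forall x : R, 0 < x < (min_prob piref)^-1 -> x * `|derive1 f x| <= cf1) ->
  has_ubound [set supnorm (fun s a => f (policy_ratio (softmax u) piref s a))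
             | u in segment theta theta'].
Proof.
move=> f_gen piref_policy piref_gt0 cf1_ge0 f_bound1.
pose w0 s a := f (policy_ratio (softmax theta) piref s a).
pose n := l2norm (theta' - theta); have n0 : 0 <= n by exact: sqrtr_ge0.
exists (supnorm w0 + 2 * n * cf1).
move=> _ [_ [t /= + <-] <-]; rewrite in_itv/= => /andP[t0 t1].
apply: supnorm_le => [|s a].
  by rewrite addr_ge0 ?supnorm_ge0// !mulr_ge0.
rewrite (_ : _ + _ *: theta' = theta + t *: (theta' - theta)); last first.
  by rewrite scalerBl scale1r scalerBr -addrA (addrC (- _)).
set u := theta + _.
have b0 := piref_pos piref_gt0 s a.
(* The sum over the actions of [H] is the term of the single action [a]. *)
pose H (b : A) (p : R) := if b == a then f (p / piref s a) else 0.
pose H1 (b : A) (p : R) := if b == a then derive1 f (p / piref s a) / piref s a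
  else 0.
have dH b (p : R) : 0 < p -> is_derive p 1 (H b) (H1 b p).
  move=> p0; rewrite /H /H1; case: eqP => _; last exact: is_derive_cst.
  exact: is_derive_generator_ratio.
have H1_bound (p : A -> R) : is_dist p -> (forall b, 0 < p b < 1) ->
    \sum_b p b * `|H1 b (p b)| <= cf1.
  move=> _ p01; rewrite (bigD1 a)//= big1 ?addr0 => [|b ba]; last first.
    by rewrite /H1 (negbTE ba) normr0 mulr0.
  rewrite /H1 eqxx normrM normfV (gtr0_norm b0) mulrA ler_pdivrMr//.
  by rewrite mulrC (mulrC cf1); rewrite mulrC; exact: generator_bound1.
have HE v : \sum_b H b (expweight (param v s) b) =
    f (policy_ratio (softmax v) piref s a).
  rewrite (bigD1 a)//= big1 ?addr0 => [|b ba]; last first.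
    by rewrite /H (negbTE ba).
  by rewrite /H eqxx.
have u_le b : `|param (u - theta) s b| <= n.
  rewrite /u addrAC subrr add0r /param mxE normrM ger0_norm//.
  by rewrite -[leRHS]mul1r ler_pM// entry_le_l2norm.
have := softmax_sum_lipschitz dH H1_bound cf1_ge0 (param theta s) u_le n0.
rewrite -param_shift !HE => /le_trans-/(_ _ (lexx _)) step.
rewrite -(subrK (w0 s a) (f _)); apply: le_trans (ler_normD _ _) _.
by rewrite addrC lerD// (entry_le_supnorm w0).
Qed.

End softmax_policy.

Section value_function.
Variables (R : realType) (S A : finType) (M : mdp R S A) (f : R -> R).
Variables (lambda : R) (piref : S -> A -> R) (rho : S -> R).

(** The expected regularized reward at a state. *)
Definition policy_reward (pi : S -> A -> R) (s : S) : R :=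
  \sum_a pi s a * (reward M s a - lambda * fdiv f (pi s) (piref s)).

(** The regularized value of the policy [pi], as an integral against the
occupancy measure. *)
Definition policy_value (pi : S -> A -> R) : R :=
  \sum_s occupancy (gamma M) (policy_kernel M pi) rho s * policy_reward pi s.

Lemma regularized_value_policy (pi : S -> A -> R)
    (d : measure_display) (Omega : measurableType d) (Pr : probability Omega R)
    (s_ : nat -> Omega -> S) (a_ : nat -> Omega -> A) :
  is_policy pi -> is_dist rho -> is_trajectory M rho pi Pr s_ a_ ->
  regularized_value M f lambda piref pi Pr s_ a_ = policy_value pi.
Proof.
move=> pip rhod traj; exact: (expected_discounted traj
  (fun s a => reward M s a - lambda * fdiv f (pi s) (piref s)) pip rhod).
Qed.

(** The unregularized reward of [a] followed by the continuation value [v]. *)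
Definition action_value (v : S -> R) (s : S) (a : A) : R :=
  reward M s a + gamma M * \sum_s' trans M s a s' * v s'.

(** Summed over [a] at [p = pi s a], this is the Bellman operator of [pi]
applied to [v] (lemma [policy_reward_bellman]). *)
Definition bellman_objective (v : S -> R) (s : S) (a : A) : R -> R :=
  regularized_term f lambda (action_value v s a) (piref s a).

Lemma policy_reward_bellman (pi : S -> A -> R) v s : is_policy pi ->
  policy_reward pi s + gamma M * \sum_s' policy_kernel M pi s s' * v s' =
  \sum_a bellman_objective v s a (pi s a).
Proof.
move=> pip; have [_ pi1] := pip s.
rewrite /policy_reward /bellman_objective /regularized_term sumrB.
rewrite -mulr_sumr -/(fdiv f (pi s) (piref s)).
under eq_bigr do rewrite mulrBr.
rewrite sumrB -mulr_suml pi1 mul1r addrAC; congr (_ - _).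
under [RHS]eq_bigr do rewrite mulrDr.
rewrite big_split/=; congr +%R.
rewrite /policy_kernel mulr_sumr.
transitivity (\sum_s' \sum_a gamma M * (pi s a * trans M s a s' * v s')).
  by apply: eq_bigr => s' _; rewrite mulr_suml mulr_sumr.
rewrite exchange_big/=; apply: eq_bigr => a _.
by rewrite !mulr_sumr; apply: eq_bigr => s' _; ring.
Qed.

Lemma policy_valueE (pi : S -> A -> R) v : is_policy pi -> is_dist rho ->
  (forall s, v s = policy_reward pi s +
     gamma M * \sum_s' policy_kernel M pi s s' * v s') ->
  policy_value pi = \sum_s rho s * v s.
Proof.
move=> pip rhod vE.
rewrite -(occupancy_balance (gamma_bound M)
  (fun s => policy_kernel_dist M s pip) v rhod).
by apply: eq_bigr => s _; rewrite [v s]vE addrK.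
Qed.

(** The occupancy measure of [pi] integrates the Bellman step from [pi] to [pi']
at [v], plus a term that couples the change of policy with [v' - v]. *)
Lemma performance_difference (pi pi' : S -> A -> R) v v' :
  is_policy pi -> is_policy pi' -> is_dist rho ->
  (forall s, v s = \sum_a bellman_objective v s a (pi s a)) ->
  (forall s, v' s = \sum_a bellman_objective v' s a (pi' s a)) ->
  policy_value pi' - policy_value pi =
  \sum_s occupancy (gamma M) (policy_kernel M pi) rho s *
    (\sum_a bellman_objective v s a (pi' s a)
     - \sum_a bellman_objective v s a (pi s a)
     + gamma M * \sum_a (pi' s a - pi s a) *
         \sum_s' trans M s a s' * (v' s' - v s')).
Proof.
move=> pip pip' rhod vE v'E.
have bellman mu u : is_policy mu ->
    (forall s, u s = \sum_a bellman_objective u s a (mu s a)) ->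
    forall s, u s = policy_reward mu s +
      gamma M * \sum_s' policy_kernel M mu s s' * u s'.
  by move=> mup uE s; rewrite policy_reward_bellman.
rewrite (policy_valueE pip' rhod (bellman _ _ pip' v'E)).
rewrite (policy_valueE pip rhod (bellman _ _ pip vE)) -sumrB.
under eq_bigr do rewrite -mulrBr.
rewrite -(occupancy_balance (gamma_bound M)
  (fun s => policy_kernel_dist M s pip) (fun s => v' s - v s) rhod).
apply: eq_bigr => s _; congr (_ * _).
rewrite -(policy_reward_bellman v s pip').
rewrite {1}(bellman _ _ pip' v'E) {1}vE.
set P' := \sum_s' policy_kernel M pi' s s' * v' s'.
have -> : \sum_a (pi' s a - pi s a) * \sum_s' trans M s a s' * (v' s' - v s')
    = P' - \sum_s' policy_kernel M pi' s s' * v s'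
      - \sum_s' policy_kernel M pi s s' * (v' s' - v s').
  rewrite /P' -sumrB; under [X in X - _]eq_bigr do rewrite -mulrBr.
  rewrite -sumrB; under [RHS]eq_bigr do rewrite -mulrBl.
  rewrite /policy_kernel.
  transitivity (\sum_s' \sum_a (pi' s a - pi s a) *
      (trans M s a s' * (v' s' - v s'))).
    by rewrite exchange_big; apply: eq_bigr => a _; rewrite mulr_sumr.
  apply: eq_bigr => s' _; rewrite -sumrB mulr_suml.
  by apply: eq_bigr => a _; rewrite -mulrBl mulrA.
ring.
Qed.

End value_function.

(** * The smoothness inequality *)

Lemma sum_enum_val (R : realType) (T : finType) (F : T -> R) :
  \sum_(i < #|T|) F (enum_val i) = \sum_x F x.
Proof.
rewrite [RHS](reindex (@enum_val T T))//.
by exists enum_rank => x _; [exact: enum_valK | exact: enum_rankK].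
Qed.

Lemma softmax_slopeE (R : realType) (A : finType) (H1 : A -> R -> R)
    (p u : A -> R) :
  softmax_slope H1 p u = \sum_a p a *
    (H1 a (p a) - average p (fun b => H1 b (p b))) * u a.
Proof.
transitivity (\sum_a p a * H1 a (p a) * u a -
    average p (fun b => H1 b (p b)) * average p u).
  rewrite mulr_suml -sumrB; apply: eq_bigr => a _; ring.
rewrite {2}/average mulr_sumr -sumrB; apply: eq_bigr => a _; ring.
Qed.

Section smoothness.
Variables (R : realType) (S A : finType) (M : mdp R S A) (f : R -> R).
Variables (lambda : R) (piref : S -> A -> R) (cf1 cf2 : R) (rho : S -> R).
Hypothesis f_gen : is_generator f.
Hypothesis lambda_gt0 : 0 < lambda.
Hypothesis piref_policy : is_policy piref.
Hypothesis piref_gt0 : 0 < min_prob piref.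
Hypothesis (cf1_gt0 : 0 < cf1) (cf2_gt0 : 0 < cf2).
Hypothesis f_bound1 : forall x : R, 0 < x < (min_prob piref)^-1 ->
  x * `|derive1 f x| <= cf1.
Hypothesis f_bound2 : forall x : R, 0 < x < (min_prob piref)^-1 ->
  x ^+ 2 * `|derive1n 2 f x| <= cf2.
Hypothesis rho_dist : is_dist rho.
Hypothesis A_gt0 : (0 < #|A|)%N.

(** A bound on the regularized rewards under the policy [pi]. *)
Definition step_reward_bound (pi : S -> A -> R) : R :=
  rmax M + lambda * supnorm (fun s a => f (policy_ratio pi piref s a)).

Lemma policy_reward_le pi s : is_policy pi ->
  `|policy_reward M f lambda piref pi s| <= step_reward_bound pi.
Proof.
move=> pip; apply: average_le => // a; apply: le_trans (ler_normB _ _) _.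
apply: lerD.
  by have /andP[r0 r1] := reward_bound M s a; rewrite ger0_norm.
rewrite normrM gtr0_norm// ler_pM2l//; apply: average_le => // b.
exact: (entry_le_supnorm (fun s a => f (policy_ratio pi piref s a))).
Qed.

(** The derivative in [p] of [bellman_objective]. *)
Definition objective_slope (v : S -> R) (s : S) (a : A) (p : R) : R :=
  action_value M v s a - lambda * derive1 f (p / piref s a).

(** The entry at [(s, a)] is the occupancy of [s], times the probability of [a],
times the advantage of [a]: the excess of the slope of its objective over the
mean slope at [s]. *)
Definition policy_gradient (pi : S -> A -> R) (v : S -> R) :
    'M[R]_(#|S|, #|A|) :=
  \matrix_(i, j) (let s := enum_val i in let a := enum_val j in
    occupancy (gamma M) (policy_kernel M pi) rho s *
    (pi s a * (objective_slope v s a (pi s a) -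
               average (pi s) (fun b => objective_slope v s b (pi s b))))).

Lemma dot_policy_gradient pi v (u : 'M[R]_(#|S|, #|A|)) :
  dot (policy_gradient pi v) u =
  \sum_s occupancy (gamma M) (policy_kernel M pi) rho s *
    softmax_slope (objective_slope v s) (pi s) (param u s).
Proof.
rewrite -[RHS]sum_enum_val; apply: eq_bigr => i _.
rewrite softmax_slopeE mulr_sumr -[RHS]sum_enum_val; apply: eq_bigr => j _.
by rewrite mxE /param !enum_valK /= -!mulrA.
Qed.

Lemma action_value_le v G s a : (forall s, `|v s| <= G) ->
  `|action_value M v s a| <= rmax M + gamma M * G.
Proof.
have /andP[g0 _] := gamma_bound M => vG.
apply: le_trans (ler_normD _ _) _; apply: lerD.
  by have /andP[r0 r1] := reward_bound M s a; rewrite ger0_norm.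
rewrite normrM ger0_norm// ler_wpM2l//.
exact: (average_le (trans_dist M s a) vG).
Qed.

(** The matrix [D] and the constant do not depend on [theta'], so the inequality
also gives differentiability at [theta]. *)
Lemma policy_value_quadratic_error theta :
  exists D : 'M[R]_(#|S|, #|A|), forall theta',
    `|policy_value M f lambda piref rho (softmax theta')
      - policy_value M f lambda piref rho (softmax theta)
      - dot D (theta' - theta)|
    <= 8 / (1 - gamma M) ^+ 3 * (step_reward_bound (softmax theta)
        + lambda * (1 - gamma M) * (cf1 + cf2 / 2)) / 2
       * l2norm (theta' - theta) ^+ 2.
Proof.
set g := gamma M; set B := step_reward_bound _.
have g01 := gamma_bound M; have /andP[g0 g1] := g01.
pose pi := softmax theta; have pip : is_policy pi by exact: softmax_policy.
have kernel_dist := fun s => policy_kernel_dist M s pip.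
have [v vE] := bellman_solution g01 kernel_dist
  (policy_reward M f lambda piref pi).
pose G := B / (1 - g); have v_le s : `|v s| <= G.
  by apply: (bellman_bound g01 kernel_dist vE) => {}s; exact: policy_reward_le.
have BG : B = G * (1 - g) by rewrite /G divfK// subr_eq0 gt_eqF.
have q_le s a : `|action_value M v s a| <= G.
  apply: le_trans (action_value_le s a v_le) _.
  have : rmax M <= B by rewrite lerDl mulr_ge0 ?supnorm_ge0// ltW.
  rewrite BG -/g; lra.
have /card_gt0P[s0 _] := dist_card_gt0 rho_dist.
have G0 : 0 <= G by exact: le_trans (v_le s0).
pose K1 := G + lambda * cf1; pose K2 := lambda * cf2.
have K1_ge0 : 0 <= K1 by rewrite addr_ge0// mulr_ge0// ltW.
have K2_ge0 : 0 <= K2 by rewrite mulr_ge0// ltW.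
have bellman_theta s : v s = \sum_a bellman_objective M f lambda piref v s a
    (pi s a) by rewrite -policy_reward_bellman.
exists (policy_gradient pi v) => theta'.
set u := theta' - theta; set n := l2norm u.
have n0 : 0 <= n by exact: sqrtr_ge0.
pose pi' := softmax theta'; have pip' : is_policy pi' by exact: softmax_policy.
have [v' v'E] := bellman_solution g01 (fun s => policy_kernel_dist M s pip')
  (policy_reward M f lambda piref pi').
have bellman_theta' s : v' s = \sum_a bellman_objective M f lambda piref v' s a
    (pi' s a) by rewrite -policy_reward_bellman.
have u_le s a : `|param u s a| <= n by exact: entry_le_l2norm.
pose obj s (mu : S -> A -> R) :=
  \sum_a bellman_objective M f lambda piref v s a (mu s a).
have dH s a (p : R) : 0 < p ->
    is_derive p 1 (bellman_objective M f lambda piref v s a)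
      (objective_slope v s a p).
  by move=> p0; apply: is_derive_regularized_term => //; exact: piref_pos.
have dH1 s a (p : R) : 0 < p -> is_derive p 1 (objective_slope v s a)
    (- (lambda * (derive1n 2 f (p / piref s a) / piref s a))).
  by move=> p0; apply: is_derive_regularized_term2 => //; exact: piref_pos.
have H1_bound s (p : A -> R) : is_dist p -> (forall a, 0 < p a < 1) ->
    \sum_a p a * `|objective_slope v s a (p a)| <= K1.
  exact: (regularized_slope_bound piref_policy piref_gt0 f_bound1 s
    (ltW lambda_gt0) (q_le s)).
have H2_bound s (p : A -> R) : is_dist p -> (forall a, 0 < p a < 1) ->
    \sum_a p a ^+ 2 *
      `|- (lambda * (derive1n 2 f (p a / piref s a) / piref s a))| <= K2.
  exact: (regularized_curvature_bound piref_policy piref_gt0 f_bound2 s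
    (ltW lambda_gt0)).
have obj_step s : `|obj s pi' - obj s pi| <= 2 * n * K1.
  have := softmax_sum_lipschitz (dH s) (H1_bound s) K1_ge0 (param theta s)
    (u_le s) n0.
  by rewrite -param_shift.
have obj_taylor s : `|obj s pi' - obj s pi -
    softmax_slope (objective_slope v s) (pi s) (param u s)|
    <= 2 * n ^+ 2 * (K1 + K2).
  have := softmax_sum_taylor (dH s) (dH1 s) (H1_bound s) (H2_bound s) K1_ge0
    K2_ge0 (param theta s) (u_le s).
  by rewrite -param_shift.
(* [v' - v] solves the Bellman equation of the new policy whose reward is the
   step of the objective at [v]. *)
pose N := 2 * n * K1 / (1 - g).
have dv_le s : `|v' s - v s| <= N.
  apply: (@bellman_bound _ _ g (policy_kernel M pi') g01
    (fun s => policy_kernel_dist M s pip') (fun s => obj s pi' - obj s pi)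
    (fun s => v' s - v s)) => // {}s.
  rewrite {1}v'E {1}bellman_theta /obj.
  rewrite -(policy_reward_bellman _ _ _ _ v s pip').
  have -> : \sum_s' policy_kernel M pi' s s' * (v' s' - v s') =
      \sum_s' policy_kernel M pi' s s' * v' s'
      - \sum_s' policy_kernel M pi' s s' * v s'.
    by rewrite -sumrB; apply: eq_bigr => s' _; rewrite mulrBr.
  rewrite -/g; ring.
have N0 : 0 <= N by exact: le_trans (dv_le s0).
(* The Lipschitz estimate for the linear functions [p |-> p * z a]. *)
have mix_le s : `|\sum_a (pi' s a - pi s a) *
    \sum_s' trans M s a s' * (v' s' - v s')| <= 2 * n * N.
  pose z a := \sum_s' trans M s a s' * (v' s' - v s').
  have z_le a : `|z a| <= N.
    exact: (average_le (trans_dist M s a) dv_le).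
  have dz a (p : R) : 0 < p -> is_derive p 1 (fun x => x * z a) (z a).
    move=> _; have /is_derive_eq := is_derive_mulR (is_derive_id p 1)
      (is_derive_cst (z a) p 1).
    by apply; rewrite mul1r mulr0 addr0.
  have z_bound (p : A -> R) : is_dist p -> (forall a, 0 < p a < 1) ->
      \sum_a p a * `|z a| <= N.
    move=> [p0 p1] _; rewrite -[leRHS]mul1r -p1 mulr_suml ler_sum// => a _.
    by rewrite ler_wpM2l.
  have := @softmax_sum_lipschitz R A (fun a x => x * z a) (fun a _ => z a) N
    dz z_bound N0 (param theta s) (param u s) n (u_le s) n0.
  rewrite -param_shift -sumrB; under eq_bigr do rewrite -mulrBl.
  by [].
rewrite (performance_difference pip pip' rho_dist bellman_theta bellman_theta').
rewrite dot_policy_gradient -sumrB; under eq_bigr do rewrite -mulrBr.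
apply: (@le_trans _ _ ((2 * n ^+ 2 * (K1 + K2) + g * (2 * n * N)) / (1 - g))).
  apply: occupancy_average_le => // s; rewrite addrAC.
  apply: le_trans (ler_normD _ _) _; apply: lerD; first exact: obj_taylor.
  by rewrite normrM ger0_norm// ler_wpM2l.
have k0 : 0 < 1 - g by rewrite subr_gt0.
(* The bound minus the estimate, with [G = B / (1 - g)], is manifestly
   nonnegative. *)
rewrite -subr_ge0 BG.
rewrite [X in 0 <= X](_ : _ = n ^+ 2 * (2 * (1 - g) * K1 + 2 * g * K2)
    / (1 - g) ^+ 2); last first.
  by rewrite /N /K1 /K2; field; rewrite gt_eqF.
by rewrite divr_ge0 ?sqr_ge0// mulr_ge0 ?sqr_ge0// addr_ge0// !mulr_ge0// ltW.
Qed.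

End smoothness.

Theorem lemma3p10 (R : realType) (S A : finType) (M : mdp R S A)
    (f : R -> R) (lambda : R) (piref : S -> A -> R) (cf1 cf2 : R)
    (rho : S -> R)
    (d : measure_display) (Omega : measurableType d)
    (Pr : 'M[R]_(#|S|, #|A|) -> probability Omega R)
    (s_ : nat -> Omega -> S) (a_ : nat -> Omega -> A)
    (V := fun theta : 'M[R]_(#|S|, #|A|) =>
       regularized_value M f lambda piref (softmax theta) (Pr theta) s_ a_)
    (f_gen : is_generator f)
    (lambda_gt0 : 0 < lambda)
    (piref_policy : is_policy piref)
    (piref_gt0 : 0 < min_prob piref)
    (cf1_gt0 : 0 < cf1) (cf2_gt0 : 0 < cf2)
    (f_bound1 : forall x : R, 0 < x < (min_prob piref)^-1 ->
       x * `|derive1 f x| <= cf1)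
    (f_bound2 : forall x : R, 0 < x < (min_prob piref)^-1 ->
       x ^+ 2 * `|derive1n 2 f x| <= cf2)
    (rho_dist : is_dist rho)
    (traj : forall theta : 'M[R]_(#|S|, #|A|),
       is_trajectory M rho (softmax theta) (Pr theta) s_ a_)
    (theta theta' : 'M[R]_(#|S|, #|A|)) :
  differentiable V theta /\
  `| V theta' - V theta - dot (gradient V theta) (theta' - theta) | <=
    smoothness M f lambda piref cf1 cf2 theta theta' / 2
    * l2norm (theta' - theta) ^+ 2.
Proof.
have /card_gt0P[s0 _] := dist_card_gt0 rho_dist.
have A_gt0 := dist_card_gt0 (piref_policy s0).
have VE y : V y = policy_value M f lambda piref rho (softmax y).
  apply: regularized_value_policy => //; exact: softmax_policy.
have [D D_error] := policy_value_quadratic_error M f_gen lambda_gt0 piref_policy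
  piref_gt0 cf1_gt0 cf2_gt0 f_bound1 f_bound2 rho_dist A_gt0 theta.
have [|V_diff V_grad] := @gradient_quadratic_error R _ _ V theta D
  (8 / (1 - gamma M) ^+ 3 * (step_reward_bound M f lambda piref (softmax theta)
    + lambda * (1 - gamma M) * (cf1 + cf2 / 2)) / 2).
  by move=> y; rewrite !VE; exact: D_error.
split=> //; rewrite V_grad !VE; apply: le_trans (D_error theta') _.
have /andP[g0 g1] := gamma_bound M.
apply: ler_wpM2r; first exact: sqr_ge0.
rewrite ler_pM2r ?invr_gt0// /smoothness ler_wpM2l//.
  by rewrite divr_ge0// exprn_ge0// subr_ge0 ltW.
rewrite lerD2r /step_reward_bound lerD2l ler_pM2l//.
apply: ub_le_sup.
  exact: (softmax_generator_bounded theta theta' f_gen piref_policy piref_gt0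
    (ltW cf1_gt0) f_bound1).
exists theta => //; exists 0; first by rewrite /= in_itv/= lexx ler01.
by rewrite subr0 scale1r scale0r addr0.
Qed.
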